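(* Let $\{\varphi_{\lambda_j}\}_{j=1}^{m}$ be orthonormal Koopman eigenfunctions in $L^2(\Omega, \rho)$, and define the kernel $$K(x, y) = \sum_{j=1}^{m} \varphi_{\lambda_j}(x) \varphi_{\lambda_j}(y).$$ Then the integral operator $T_K$ on $L^2(\rho)$ has rank $m$, eigenvalue $1$, and its eigenfunctions are precisely $\{\varphi_{\lambda_j}\}_{j=1}^m$.
   Context: $\Omega\subset\mathbb{R}^d$ is a domain with a measure $\rho$, and $f$ is a vector field on $\Omega$. A Koopman eigenfunction with eigenvalue $\lambda$ is a function $\varphi_\lambda$ satisfying $f(x)\cdot\nabla\varphi_\lambda(x)=\lambda\varphi_\lambda(x)$. The integral operator is $[T_K g](x)=\int_\Omega K(x,y)g(y)\,d\rho(y)$. *)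

(* Defs.v *)
From mathcomp Require Import all_boot all_order all_algebra.
From mathcomp Require Import all_classical all_reals all_analysis.

Set Implicit Arguments.
Unset Strict Implicit.
Unset Printing Implicit Defensive.
Import Order.TTheory GRing.Theory Num.Theory.
Import numFieldNormedType.Exports.
Local Open Scope classical_set_scope.
Local Open Scope ring_scope.

(* R^d with its Borel sigma-algebra *)
Notation borelRd R d := (g_sigma_algebraType (@open 'rV[R]_d)).

Definition is_domain (R : realType) (d : nat) (Omega : set 'rV[R]_d) : Prop :=
  [/\ open Omega, connected Omega & Omega !=set0].

Definition gradient (R : realType) (d : nat) (phi : 'rV[R]_d -> R)
    (x : 'rV[R]_d) : 'rV[R]_d :=
  \row_(i < d) 'D_(delta_mx 0 i) phi x.

Definition dotv (R : realType) (d : nat) (u v : 'rV[R]_d) : R :=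
  \sum_(i < d) u 0 i * v 0 i.

Definition koopman_eigenfunction (R : realType) (d : nat)
    (Omega : set 'rV[R]_d) (f : 'rV[R]_d -> 'rV[R]_d)
    (lambda : R) (phi : 'rV[R]_d -> R) : Prop :=
  forall x, Omega x ->
    differentiable phi x /\ dotv (f x) (gradient phi x) = lambda * phi x.

(* Elements of the real space L^2(D, mu) are represented by functions on the
   ambient space, of which only the values on D matter; they are compared
   almost everywhere on D. *)
Section L2.
Context (disp : measure_display) (T : measurableType disp) (R : realType).
Variables (mu : {measure set T -> \bar R}) (D : set T).

Definition L2 (g : T -> R) : Prop := g \_ D \in Lfun mu 2%:E.

Definition L2_eq (g h : T -> R) : Prop := ae_eq mu D g h.

Definition L2_dot (g h : T -> R) : R := \int[mu]_(x in D) (g x * h x).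

Definition L2_orthonormal (m : nat) (phi : 'I_m -> T -> R) : Prop :=
  (forall i, L2 (phi i)) /\
  (forall i j, L2_dot (phi i) (phi j) = (i == j)%:R).

Definition lincomb (m : nat) (c : 'I_m -> R) (b : 'I_m -> T -> R) (x : T) : R :=
  \sum_(i < m) c i * b i x.

Definition L2_span (m : nat) (b : 'I_m -> T -> R) (g : T -> R) : Prop :=
  exists c : 'I_m -> R, L2_eq g (lincomb c b).

Definition L2_free (m : nat) (b : 'I_m -> T -> R) : Prop :=
  forall c : 'I_m -> R, L2_eq (lincomb c b) (cst 0) -> forall i, c i = 0.

(* S induces a linear operator on L^2(D, mu) *)
Definition L2_operator (S : (T -> R) -> (T -> R)) : Prop :=
  [/\ forall g, L2 g -> L2 (S g),
      forall g h, L2 g -> L2 h -> L2_eq g h -> L2_eq (S g) (S h)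
    & forall (a : R) g h, L2 g -> L2 h ->
        L2_eq (S (fun x => a * g x + h x)) (fun x => a * S g x + S h x)].

(* The range of S in L^2(D, mu) has a basis with m elements. *)
Definition L2_rank (S : (T -> R) -> (T -> R)) (m : nat) : Prop :=
  exists g : 'I_m -> T -> R,
    [/\ forall i, L2 (g i),
        L2_free (fun i => S (g i))
      & forall h, L2 h -> L2_span (fun i => S (g i)) (S h)].

Definition L2_eigenfunction (S : (T -> R) -> (T -> R)) (lambda : R)
    (g : T -> R) : Prop :=
  [/\ L2 g, ~ L2_eq g (cst 0) & L2_eq (S g) (fun x => lambda * g x)].

Definition L2_eigenvalue (S : (T -> R) -> (T -> R)) (lambda : R) : Prop :=
  exists g, L2_eigenfunction S lambda g.

Definition integral_operator (K : T -> T -> R) (g : T -> R) (x : T) : R :=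
  \int[mu]_(y in D) (K x y * g y).

Definition sum_kernel (m : nat) (phi : 'I_m -> T -> R) (x y : T) : R :=
  \sum_(j < m) phi j x * phi j y.

End L2.

(* Main.v *)
Require Import Defs.
From mathcomp Require Import all_boot all_order all_algebra.
From mathcomp Require Import all_classical all_reals all_analysis.
Set Implicit Arguments.
Unset Strict Implicit.
Unset Printing Implicit Defensive.
Import Order.TTheory GRing.Theory Num.Theory.
Import numFieldNormedType.Exports.
Local Open Scope classical_set_scope.
Local Open Scope ring_scope.

(** By orthonormality, [T_K g = \sum_j <phi_j, g> phi_j] is the orthogonal
    projection onto the span of the [phi_j], so its range, its eigenspace for
    [1] and the span all coincide. If [T_K g = mu g] with [mu != 0], then [g]
    lies in the range, hence is fixed by [T_K], hence [mu = 1]. *)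

(** * The inner product on L^2 and finite linear combinations *)

Section L2_theory.
Context (disp : measure_display) (T : measurableType disp) (R : realType).
Variables (mu : {measure set T -> \bar R}) (D : set T).
Hypothesis mD : measurable D.

Lemma L2_linear (a : R) (g h : T -> R) :
  L2 mu D g -> L2 mu D h -> L2 mu D (fun x => a * g x + h x).
Proof.
rewrite /L2 => Lg Lh.
have -> : (fun x => a * g x + h x) \_ D = fun x => a * (g \_ D) x + (h \_ D) x.
  apply/funext => x; rewrite !patchE; case: ifP => // _.
  by rewrite mulr0 addr0.
have p1 : (1 <= 2%:E :> \bar R)%E by rewrite lee_fin ler1n.
by have [_] := Lfun_submod_closed mu p1; apply.
Qed.

Lemma L2_0 : L2 mu D (cst 0).
Proof.
have p1 : (1 <= 2%:E :> \bar R)%E by rewrite lee_fin ler1n.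
rewrite /L2; have -> : (cst 0 : T -> R) \_ D = 0.
  by apply/funext => x; rewrite patchE; case: ifP.
by have [] := Lfun_submod_closed mu p1.
Qed.

(** Hölder's inequality with exponents 2 and 2; the integrals defining [L2_dot] and
    [integral_operator] thus converge. *)
Lemma L2_integrableM (g h : T -> R) : L2 mu D g -> L2 mu D h ->
  mu.-integrable D (fun x => (g x * h x)%:E).
Proof.
move=> Lg Lh; apply/integrable_mkcond => //.
have /Lfun1_integrable := Lfun2_mul_Lfun1 Lg Lh.
congr integrable; apply/funext => x /=; rewrite !patchE.
by case: ifP => //; rewrite mul0r.
Qed.

Lemma L2_eq_dot (f g h : T -> R) : L2 mu D f -> L2 mu D g -> L2 mu D h ->
  L2_eq mu D g h -> L2_dot mu D f g = L2_dot mu D f h.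
Proof.
move=> Lf Lg Lh gh; congr fine; apply: ae_eq_integral => //.
- exact: measurable_int (L2_integrableM Lf Lg).
- exact: measurable_int (L2_integrableM Lf Lh).
- by apply: filterS gh => x + Dx => /(_ Dx) ->.
Qed.

Lemma L2_dot_linear (a : R) (f g h : T -> R) :
  L2 mu D f -> L2 mu D g -> L2 mu D h ->
  L2_dot mu D f (fun x => a * g x + h x) = a * L2_dot mu D f g + L2_dot mu D f h.
Proof.
move=> Lf Lg Lh; have ifg := L2_integrableM Lf Lg.
rewrite /L2_dot -RintegralZl// -RintegralD//.
- by apply: eq_Rintegral => x _; rewrite mulrDr mulrCA.
- exact: integrableZl ifg.
- exact: L2_integrableM.
Qed.

Lemma L2_dot0 (f : T -> R) : L2_dot mu D f (cst 0) = 0.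
Proof.
(* The right-hand 0 becomes the integral of the constant 0; the factor 0 makes this valid even if
   [D] has infinite measure. *)
rewrite /L2_dot -[RHS](mul0r (fine (mu D))) -Rintegral_cst//.
by apply: eq_Rintegral => x _; rewrite mulr0.
Qed.

(** Peels off one term in the shape [a * g x + h x] of the linearity lemmas, for inductions on
    [m]. *)
Lemma lincombE m (c : 'I_m.+1 -> R) (b : 'I_m.+1 -> T -> R) :
  lincomb c b = fun x => c ord0 * b ord0 x +
    lincomb (fun i => c (lift ord0 i)) (fun i => b (lift ord0 i)) x.
Proof. by apply/funext => x; rewrite /lincomb big_ord_recl. Qed.

Lemma lincomb0 (c : 'I_0 -> R) (b : 'I_0 -> T -> R) : lincomb c b = cst 0.
Proof. by apply/funext => x; rewrite /lincomb big_ord0. Qed.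

Lemma L2_lincomb m (c : 'I_m -> R) (b : 'I_m -> T -> R) :
  (forall i, L2 mu D (b i)) -> L2 mu D (lincomb c b).
Proof.
elim: m c b => [|m ih] c b Lb; first by rewrite lincomb0; exact: L2_0.
by rewrite lincombE; apply: L2_linear => //; exact: ih.
Qed.

Lemma L2_dot_lincomb m (f : T -> R) (c : 'I_m -> R) (b : 'I_m -> T -> R) :
  L2 mu D f -> (forall i, L2 mu D (b i)) ->
  L2_dot mu D f (lincomb c b) = \sum_(i < m) c i * L2_dot mu D f (b i).
Proof.
move=> Lf; elim: m c b => [|m ih] c b Lb.
  by rewrite lincomb0 L2_dot0 big_ord0.
rewrite lincombE L2_dot_linear//; last exact: L2_lincomb.
by rewrite ih// big_ord_recl.
Qed.

(** * The operator whose kernel comes from an orthonormal family *)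

Section orthonormal.
Context (m : nat) (phi : 'I_m -> T -> R).
Hypothesis phi_on : L2_orthonormal mu D phi.
Let Lphi : forall i, L2 mu D (phi i) := phi_on.1.
Let TK := integral_operator mu D (sum_kernel phi).

Lemma orthonormal_dot_lincomb (c : 'I_m -> R) i :
  L2_dot mu D (phi i) (lincomb c phi) = c i.
Proof.
rewrite L2_dot_lincomb// (bigD1 i)//= big1 => [|j ji]; rewrite phi_on.2.
  by rewrite eqxx mulr1 addr0.
by rewrite eq_sym (negbTE ji) mulr0.
Qed.

Lemma orthonormal_free : L2_free mu D phi.
Proof.
move=> c c0 i; rewrite -(orthonormal_dot_lincomb c i).
rewrite (L2_eq_dot _ _ _ c0) ?L2_dot0//; [exact: L2_lincomb|exact: L2_0].
Qed.

Lemma orthonormal_neq0 i : ~ L2_eq mu D (phi i) (cst 0).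
Proof.
move=> phi0; have := phi_on.2 i i; rewrite (L2_eq_dot _ _ _ phi0)//.
  by rewrite L2_dot0 eqxx => /esym/eqP; rewrite oner_eq0.
exact: L2_0.
Qed.

Lemma sum_kernel_integrable (g : T -> R) x : L2 mu D g ->
  mu.-integrable D (fun y => (sum_kernel phi x y * g y)%:E).
Proof.
move=> Lg; apply: (L2_integrableM (g := sum_kernel phi x)) => //.
exact: (L2_lincomb (phi ^~ x)).
Qed.

(** For fixed [x], the section [sum_kernel phi x] is the combination of the [phi j] with
    coefficients [phi j x], so linearity of the inner product applies. The equality holds at every
    point, not just almost everywhere. *)
Lemma sum_kernel_operatorE (g : T -> R) : L2 mu D g ->
  TK g = lincomb (fun j => L2_dot mu D (phi j) g) phi.
Proof.
move=> Lg; apply/funext => x.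
have dotC f h : L2_dot mu D f h = L2_dot mu D h f.
  by apply: eq_Rintegral => y _; rewrite mulrC.
rewrite -[LHS]/(L2_dot mu D (lincomb (phi ^~ x) phi) g) dotC L2_dot_lincomb//.
by apply: eq_bigr => j _; rewrite dotC mulrC.
Qed.

Lemma sum_kernel_operator_lincomb (c : 'I_m -> R) :
  TK (lincomb c phi) = lincomb c phi.
Proof.
rewrite sum_kernel_operatorE; last exact: L2_lincomb.
by congr lincomb; apply/funext => j; rewrite orthonormal_dot_lincomb.
Qed.

Lemma sum_kernel_operator_phi i : TK (phi i) = phi i.
Proof.
have {1 2}-> : phi i = lincomb (fun j => (j == i)%:R) phi.
  apply/funext => x; rewrite /lincomb (bigD1 i)//= eqxx mul1r big1 ?addr0//.
  by move=> j /negbTE ->; rewrite mul0r.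
exact: sum_kernel_operator_lincomb.
Qed.

(** [TK g] depends on [g] only through the inner products with the [phi j], which are linear and
    respect a.e. equality. *)
Lemma sum_kernel_L2_operator : L2_operator mu D TK.
Proof.
split=> [g Lg|g h Lg Lh gh|a g h Lg Lh].
- by rewrite sum_kernel_operatorE//; exact: L2_lincomb.
- rewrite !sum_kernel_operatorE//; apply: aeW => x _.
  by apply: eq_bigr => j _; rewrite (L2_eq_dot _ _ _ gh).
- rewrite !sum_kernel_operatorE//; last exact: L2_linear.
  apply: aeW => x _; rewrite /lincomb mulr_sumr -big_split/=.
  by apply: eq_bigr => j _; rewrite L2_dot_linear// mulrDl mulrA.
Qed.

Lemma sum_kernel_fixed (g : T -> R) : L2 mu D g ->
  L2_eq mu D (TK g) g <-> L2_span mu D phi g.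
Proof.
move=> Lg; split=> [fg|[c gc]].
  exists (fun j => L2_dot mu D (phi j) g); rewrite -sum_kernel_operatorE//.
  exact: ae_eq_sym.
have [_ TK_eq _] := sum_kernel_L2_operator.
(* The combination is replaced by its own image, so that the claim becomes compatibility of [TK]
   with [gc]. *)
apply: ae_eq_trans (ae_eq_sym gc); rewrite -sum_kernel_operator_lincomb.
by apply: TK_eq => //; exact: L2_lincomb.
Qed.

Lemma sum_kernel_eigenfunction i : L2_eigenfunction mu D TK 1 (phi i).
Proof.
split=> //; first exact: orthonormal_neq0.
by rewrite sum_kernel_operator_phi; apply: aeW => x _; rewrite mul1r.
Qed.

Lemma sum_kernel_eigenvalue (k : R) : k != 0 -> L2_eigenvalue mu D TK k ->
  k = 1.
Proof.
move=> k0 [g [Lg g0 gk]]; apply/eqP/negP => /negP k1; apply: g0.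
have /sum_kernel_fixed : L2_span mu D phi g.
  (* Coefficients obtained by dividing [TK g = k g] by [k]. *)
  exists (fun j => k^-1 * L2_dot mu D (phi j) g).
  move: gk; rewrite sum_kernel_operatorE//; apply: filterS => x + Dx.
  move=> /(_ Dx) /(congr1 ( *%R k^-1)); rewrite mulKf// => <-.
  by rewrite /lincomb mulr_sumr; apply: eq_bigr => j _; rewrite mulrA.
(* Now [TK g] equals both [k g] and [g] a.e., so [(k - 1) g = 0] a.e., and [k != 1] forces [g = 0]
   a.e. *)
move=> /(_ Lg); apply: filterS2 gk => x + + Dx => /(_ Dx) -> /(_ Dx) /eqP.
by rewrite -subr_eq0 -{2}[g x]mul1r -mulrBl mulf_eq0 subr_eq0 (negbTE k1) => /eqP.
Qed.

Lemma sum_kernel_rank : L2_rank mu D TK m.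
Proof.
(* The [phi i] are their own images, so they serve both as preimages and as the basis of the
   range. *)
exists phi; have -> : (fun i => TK (phi i)) = phi.
  by apply/funext => i; exact: sum_kernel_operator_phi.
split=> // [|h Lh]; first exact: orthonormal_free.
exists (fun j => L2_dot mu D (phi j) h).
by rewrite sum_kernel_operatorE//; exact: ae_eq_refl.
Qed.

End orthonormal.
End L2_theory.

Theorem lemma3p3 (R : realType) (d m : nat) (Omega : set 'rV[R]_d)
    (rho : {measure set (borelRd R d) -> \bar R})
    (f : 'rV[R]_d -> 'rV[R]_d)
    (lambda : 'I_m -> R) (phi : 'I_m -> borelRd R d -> R) :
  (0 < m)%N ->
  is_domain Omega ->
  (forall j, koopman_eigenfunction Omega f (lambda j) (phi j)) ->
  L2_orthonormal rho Omega phi ->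
  let K := sum_kernel phi in
  let TK := integral_operator rho Omega K in
  [/\ (* T_K is a well-defined operator on L^2 *)
      (forall g, L2 rho Omega g -> forall x, Omega x ->
         rho.-integrable Omega (fun y => (K x y * g y)%:E))
      /\ L2_operator rho Omega TK,
      L2_rank rho Omega TK m,
      (* 1 is an eigenvalue, and the only nonzero one *)
      L2_eigenvalue rho Omega TK 1
      /\ (forall mu, mu != 0 -> L2_eigenvalue rho Omega TK mu -> mu = 1),
      forall j, L2_eigenfunction rho Omega TK 1 (phi j)
    & (* the phi j form a basis of the eigenspace of 1 *)
      L2_free rho Omega phi /\
      forall g, L2 rho Omega g ->
        (L2_eq rho Omega (TK g) g <-> L2_span rho Omega phi g)].
Proof.
move=> m0 [oOmega _ _] _ phi_on K TK.
have mOmega : measurable (Omega : set (borelRd R d)) by exact: sub_sigma_algebra.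
split.
- by split=> [g Lg x _|]; [exact: sum_kernel_integrable|exact: sum_kernel_L2_operator].
- exact: sum_kernel_rank.
- split; last by move=> k; exact: sum_kernel_eigenvalue.
  (* Positivity of [m] supplies an index, hence an eigenvector. *)
  by exists (phi (Ordinal m0)); exact: sum_kernel_eigenfunction.
- by move=> j; exact: sum_kernel_eigenfunction.
- by split; [exact: orthonormal_free|move=> g; exact: sum_kernel_fixed].
Qed.
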